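(* Let $k\in\mathbb{N}_0$, $\alpha\in\mathbb{R}$, $\beta\in\mathbb{R}$ with $\beta>-1$, and $\rho\in\mathbb{C}\setminus\{0\}$. Then $$\int_0^\infty x^{\beta-\alpha/2}e^{-x}J_\alpha\!\left(2\sqrt{\rho x}\right)L_k^\beta(x)\,dx=\Gamma(\beta-\alpha+1)\,\frac{e^{-\rho}\rho^{k+\alpha/2}}{k!}\,L_{\beta-\alpha}^{\alpha+k}(\rho).$$
   Context: $\mathbb{N}_0=\{0,1,2,\dots\}$. Square roots and complex powers are principal. $(z)_n:=\prod_{i=1}^n(z+i-1)$ is the Pochhammer symbol and $M(a,b,z):=\sum_{n=0}^\infty\frac{(a)_n}{(b)_n}\frac{z^n}{n!}$ is Kummer's confluent hypergeometric function. The Bessel function of the first kind is $J_\nu(z):=\frac{(z/2)^\nu}{\Gamma(\nu+1)}\,{}_0F_1\left(-;\nu+1;-\frac{z^2}{4}\right)=\sum_{n=0}^\infty\frac{(-1)^n(z/2)^{2n+\nu}}{n!\,\Gamma(\nu+n+1)}$ ($1/\Gamma$ entire). The Laguerre polynomials are $L_n^\beta(z):=\frac{(\beta+1)_n}{n!}M(-n,\beta+1,z)$, $n\in\mathbb{N}_0$, $\beta>-1$. The Laguerre function is, for $\nu,\alpha\in\mathbb{C}$, $$L_\nu^\alpha(z):=\frac{\Gamma(1+\nu+\alpha)}{\Gamma(\nu+1)\Gamma(\alpha+1)}M(-\nu,\alpha+1,z).$$ When gamma factors are singular, $\Gamma(\beta-\alpha+1)\,L_{\beta-\alpha}^{\alpha+k}(\rho)$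 is understood by continuity in the parameters as $\Gamma(\beta+k+1)\sum_{n=0}^\infty\frac{(\alpha-\beta)_n\rho^n}{\Gamma(\alpha+k+n+1)\,n!}$. *)

(* Defs.v *)
From mathcomp Require Export all_boot all_order all_algebra.
From mathcomp Require Export all_classical all_reals all_analysis.
From mathcomp.real_closed Require Export complex.
Export Order.TTheory GRing.Theory Num.Theory.
Export numFieldTopology.Exports numFieldNormedType.Exports.

Set Implicit Arguments.
Unset Strict Implicit.
Unset Printing Implicit Defensive.

Open Scope classical_set_scope.
Open Scope ring_scope.
Open Scope complex_scope.

Section elementary_functions.
Context {R : realType}.
Implicit Types z w : R[i].

(* The limit is taken in the norm topology of the field R[i]. *)
Definition csum (u : nat -> R[i]) : R[i] := limn (series (u : nat -> R[i]^o)).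

Definition cexp z : R[i] :=
  (expR (complex.Re z) * cos (complex.Im z))
    +i* (expR (complex.Re z) * sin (complex.Im z)).

(* Principal argument, in ]-pi, pi] for z != 0. *)
Definition carg z : R :=
  let t := acos (complex.Re z / Normc.normc z) in
  if 0 <= complex.Im z then t else - t.

Definition clog z : R[i] := ln (Normc.normc z) +i* carg z.

(* Principal power z^w. The principal square root is [sqrtc] (whose value on
   the negative axis is i * sqrt |z|), not [sqrtC] from the numeric-field
   library: the latter selects the root with nonnegative imaginary part. *)
Definition cpow z w : R[i] :=
  if z == 0 then (w == 0)%:R else cexp (w * clog z).

Definition cintegrable (D : set R) (f : R -> R[i]) : Prop :=
  (@lebesgue_measure R).-integrable D (fun x => (complex.Re (f x))%:E) /\
  (@lebesgue_measure R).-integrable D (fun x => (complex.Im (f x))%:E).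

Definition cintegral (D : set R) (f : R -> R[i]) : R[i] :=
  (\int[@lebesgue_measure R]_(x in D) complex.Re (f x))
    +i* (\int[@lebesgue_measure R]_(x in D) complex.Im (f x)).

End elementary_functions.

Section special_functions.
Context {R : realType}.
Implicit Types z a b nu : R[i].

Definition cpoch z (n : nat) : R[i] := \prod_(i < n) (z + i%:R).

Definition euler_integral z : R[i] :=
  cintegral `]0, +oo[ (fun t => cpow t%:C (z - 1) * (expR (- t))%:C).

(* Euler's integral continued by Gamma(z) = Gamma(z + n) / (z)_n, with n large
   enough that Re (z + n) > 0. At the poles the denominator vanishes, so
   [cGamma z = 0] there, and [(cGamma z)^-1] is the entire function 1/Gamma at
   every z, including its zeros. *)
Definition cGamma z : R[i] :=
  let n := (Num.truncn `|complex.Re z|).+1 in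
  euler_integral (z + n%:R) / cpoch z n.

Definition kummerM a b z : R[i] :=
  csum (fun n => cpoch a n / cpoch b n * (z ^+ n / n`!%:R)).

Definition besselJ nu z : R[i] :=
  csum (fun n => (-1) ^+ n * cpow (z / 2) (2 * n%:R + nu)
                 / (n`!%:R * cGamma (nu + n%:R + 1))).

Definition laguerre_poly (n : nat) (b : R) z : R[i] :=
  cpoch (b%:C + 1) n / n`!%:R * kummerM (- n%:R) (b%:C + 1) z.

Definition laguerre_fun nu a z : R[i] :=
  cGamma (1 + nu + a) / (cGamma (nu + 1) * cGamma (a + 1))
  * kummerM (- nu) (a + 1) z.

Definition gamma_pole (x : R) : Prop := exists m : nat, x = - m%:R.

(* Gamma(b - a + 1) * L_(b - a)^(a + k)(z), read through its continuous
   extension in (a, b) when Gamma(b - a + 1) or Gamma(a + k + 1) is singular. *)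
Definition gamma_laguerre (k : nat) (a b : R) z : R[i] :=
  if `[< gamma_pole (b - a + 1) \/ gamma_pole (a + k%:R + 1) >] then
    cGamma (b + k%:R + 1)%:C
    * csum (fun n => cpoch (a - b)%:C n * z ^+ n
                     / (cGamma (a + k%:R + n%:R + 1)%:C * n`!%:R))
  else
    cGamma (b - a + 1)%:C * laguerre_fun (b - a)%:C (a + k%:R)%:C z.

End special_functions.

(* Main.v *)
From HB Require Import structures.
Require Import Defs.
From mathcomp Require Import measurable_realfun zify ring lra.

(** The idea is to expand the Bessel function in powers of [x] and to integrate
    term by term.

    For [x > 0] the principal logarithm of [sqrt (rho x)] is half of
    [log rho + ln x] ([clog_sqrtc], [clog_scale]), so the Bessel series is
    [rho^(a/2)] times the sum of
    [(- rho)^n x^(n + a/2) / (n! Gamma(a + n + 1))] ([csums_besselJ]), and the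
    integrand becomes a series of constants times the functions
    [x^(b + n) e^(-x) L_k^b(x)].  The integral of such a function is
    [Gamma(b + n + 1) (-n)_k / k!] ([Rintegral_laguerre_density]): it is a
    finite sum of values of Gamma which a Chu-Vandermonde identity
    ([poch_vandermonde]) evaluates.  In particular the first [k] terms vanish,
    which is where the factor [rho^k] comes from.  Sum and integral may be
    exchanged by dominated convergence ([integral_series]), because the series
    of the L1 norms has term ratio of order [1/n]: the growth of the moments is
    compensated by the Gamma function of the Bessel series, and the factorial
    is left over ([cvg_series_rgamma_term]).

    After the shift by [k] ([shifted_moment_term]) the integral is, up to
    elementary factors, the sum of [(B)_m (- rho)^m / (m! Gamma(c + m))] with
    [B = b + k + 1] and [c = a + k + 1].  Kummer's transformation
    ([kummer_transformation]) rewrites it as [e^(- rho)] times the sum of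
    [(c - B)_m rho^m / (m! Gamma(c + m))]; comparing coefficients in the Cauchy
    product with the exponential series gives the same Chu-Vandermonde identity
    once more.  Since [c - B = a - b], the result is the Laguerre function on the
    right-hand side ([gamma_laguerreE]).

    All Gamma functions in denominators are handled through [1 / Gamma], with
    value [0] at the poles.  It satisfies [1/Gamma(x) = x (1/Gamma(x + 1))] for
    every real [x] ([GammaV_rec]), so no argument about poles enters before the
    final comparison with the two branches of the right-hand side.  The Gamma
    function itself is obtained from Euler's integral, whose finiteness,
    positivity and functional equation are proved first. *)

Set Implicit Arguments.
Unset Strict Implicit.
Unset Printing Implicit Defensive.

(** * Series of complex numbers *)

Section complex_series.
Context {R : realType}.
Implicit Types (u v : nat -> R[i]) (s t : R[i]).

(** Convergence is taken componentwise so that all limits are limits of real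
    sequences; [csumE] relates this to convergence in the norm. *)
Definition csums u s : Prop :=
  series (fun n => complex.Re (u n)) @ \oo --> complex.Re s /\
  series (fun n => complex.Im (u n)) @ \oo --> complex.Im s.

Lemma norm_le_ReIm (z : R[i]) :
  `|z| <= (`|complex.Re z| + `|complex.Im z|)%:C.
Proof.
rewrite normc_def lecR -[leRHS]ger0_norm ?addr_ge0// -sqrtr_sqr ler_wsqrtr//.
rewrite -[complex.Re z ^+ 2]real_normK ?num_real//.
rewrite -[complex.Im z ^+ 2]real_normK ?num_real//.
have := normr_ge0 (complex.Re z); have := normr_ge0 (complex.Im z); nra.
Qed.

Lemma csumE u s : csums u s -> csum u = s.
Proof.
move=> [uR uI]; rewrite /csum; apply: (cvg_lim (@norm_hausdorff _ (R[i]^o))).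
apply/cvgrPdist_lt => -[e e'] /=; rewrite ltcE/= => /andP[/eqP -> e0].
near=> n.
apply: le_lt_trans (norm_le_ReIm _) _; rewrite (ltcR _ e) (splitr e) ltrD//.
  rewrite raddfB raddf_sum; near: n; move/cvgrPdist_lt : uR; apply; lra.
rewrite raddfB raddf_sum; near: n; move/cvgrPdist_lt : uI; apply; lra.
Unshelve. all: by end_near. Qed.

Lemma eq_csums u v s : (forall n, u n = v n) -> csums u s -> csums v s.
Proof. by move=> /funext ->. Qed.

Lemma csums_unique u s t : csums u s -> csums u t -> s = t.
Proof. by move=> /csumE <- /csumE. Qed.

Lemma csumsZ c u s : csums u s -> csums (fun n => c * u n) (c * s).
Proof.
move=> [uR uI]; split.
- have -> : series (fun n => complex.Re (c * u n)) =
    (fun n => complex.Re c * series (fun n => complex.Re (u n)) n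
            - complex.Im c * series (fun n => complex.Im (u n)) n).
    apply/funext => n; rewrite /series/= !mulr_sumr -sumrB; apply: eq_bigr => i _.
    by case: c (u i) => [? ?] [? ?].
  have -> : complex.Re (c * s) =
    complex.Re c * complex.Re s - complex.Im c * complex.Im s.
    by case: c s {uR uI} => [? ?] [? ?].
  by apply: cvgB; apply: cvgMr.
- have -> : series (fun n => complex.Im (c * u n)) =
    (fun n => complex.Re c * series (fun n => complex.Im (u n)) n
            + complex.Im c * series (fun n => complex.Re (u n)) n).
    apply/funext => n; rewrite /series/= !mulr_sumr -big_split; apply: eq_bigr => i _.
    by case: c (u i) => [? ?] [? ?].
  have -> : complex.Im (c * s) =
    complex.Re c * complex.Im s + complex.Im c * complex.Re s.
    by case: c s {uR uI} => [? ?] [? ?].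
  by apply: cvgD; apply: cvgMr.
Qed.

(** Discards the vanishing terms [n < k] of the integrated Bessel series. *)
Lemma csums_shift k u s : (forall n, (n < k)%N -> u n = 0) ->
  csums u s <-> csums (fun n => u (k + n)%N) s.
Proof.
move=> u0.
have E (f : R[i] -> R) : f 0 = 0 -> series (fun n => f (u (k + n)%N)) =
    (fun n => series (fun n => f (u n)) (n + k)%N).
  move=> f0; apply/funext => n; rewrite /series/=.
  rewrite (@big_cat_nat _ _ _ k 0 (n + k))//= ?leq_addl//.
  have -> : \sum_(0 <= i < k) f (u i) = 0.
    by rewrite big_nat big1// => i /andP[_ ik]; rewrite u0// f0.
  rewrite add0r.
  by rewrite -{2}[k]add0n big_addn addnK; apply: eq_bigr => i _; rewrite addnC.
rewrite /csums.
by rewrite (E (@complex.Re R))// (E (@complex.Im R))// !cvg_shiftn.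
Qed.

End complex_series.

(** * Cauchy products *)

Section real_cauchy_product.
Context {R : realType}.
Implicit Types (a b : nat -> R) (s t : R).

Definition convol {K : nzRingType} (a b : nat -> K) : nat -> K :=
  fun n => \sum_(i < n.+1) a i * b (n - i)%N.

Lemma series_convol a b n :
  series (convol a b) n = \sum_(0 <= i < n) a i * series b (n - i)%N.
Proof.
rewrite /series/=; elim: n => [|n IH]; first by rewrite !big_geq.
rewrite big_nat_recr//= IH /convol [in RHS]big_nat_recr//=.
rewrite -(big_mkord xpredT (fun i => a i * b (n - i)%N)) big_nat_recr//= addrA.
rewrite subnn subSnn big_nat1; congr (_ + _).
rewrite -big_split/= !big_nat; apply: eq_bigr => i /andP[_ iN].
by rewrite subSn 1?ltnW// big_nat_recr//= mulrDr.
Qed.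

Lemma cvg_half : (fun n => n./2) @ \oo --> \oo.
Proof.
move=> A [N _ NA]; exists N.*2 => // n /= Nn; apply: NA => /=.
by rewrite -(doubleK N) half_leq.
Qed.

Lemma series_le_series (a : nat -> R) m n : (forall i, 0 <= a i) ->
  (m <= n)%N -> series a m <= series a n.
Proof. by move=> a0; apply/nondecreasing_series => i _ _. Qed.

(** The index pairs with [i + j < n] contain a square of side [n./2] and lie in
    a square of side [n], so the partial sums of the Cauchy product are squeezed
    between two products of partial sums. *)
Lemma cvg_series_convol_ge0 a b s t : (forall n, 0 <= a n) -> (forall n, 0 <= b n) ->
  series a @ \oo --> s -> series b @ \oo --> t ->
  series (convol a b) @ \oo --> s * t.
Proof.
move=> a0 b0 as_ bt.
apply: (@squeeze_cvgr _ _ _ _ (fun n => series a n./2 * series b n./2)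
   (fun n => series a n * series b n)); last 2 first.
- exact: (cvg_comp _ _ cvg_half (cvgM as_ bt)).
- exact: cvgM.
apply: nearW => n; rewrite series_convol; apply/andP; split.
- rewrite [leRHS](@big_cat_nat _ _ _ n./2)//= ?half_leqnn//; last first.
    by rewrite -[leqRHS](half_bit_double n false) half_leq// -addnn leq_addr.
  rewrite -[leLHS]addr0 lerD//; last first.
    by apply: sumr_ge0 => i _; rewrite mulr_ge0// sumr_ge0.
  rewrite [X in X * _ <= _]/series/= mulr_suml !big_nat ler_sum// => i /andP[_ ih].
  rewrite ler_wpM2l// series_le_series//.
  by have := odd_double_half n; lia.
- rewrite [X in _ <= X * _]/series/= mulr_suml ler_sum// => i _.
  by rewrite ler_wpM2l// series_le_series// leq_subr.
Qed.

(** The difference between the product of the [n]th partial sums and the [n]th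
    partial sum of the Cauchy product runs over the pairs with [i + j >= n]; it
    is dominated by the same difference for the absolute values, which tends to
    0 by the nonnegative case. *)
Lemma cvg_series_convol a b s t :
  cvgn (series (fun n => `|a n|)) -> cvgn (series (fun n => `|b n|)) ->
  series a @ \oo --> s -> series b @ \oo --> t ->
  series (convol a b) @ \oo --> s * t.
Proof.
move=> /cvg_ex[s' /= as'] /cvg_ex[t' /= bt'] as_ bt.
have C' := cvg_series_convol_ge0 (fun n => normr_ge0 (a n)) (fun n => normr_ge0 (b n)) as' bt'.
set a' := fun n => `|a n| in as' C'; set b' := fun n => `|b n| in bt' C'.
have D0 : (fun n => series a n * series b n - series (convol a b) n) @ \oo --> 0.
  apply/norm_cvg0P.
  apply: (@squeeze_cvgr _ _ _ _ (fun=> 0)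
     (fun n => series a' n * series b' n - series (convol a' b') n)); last 2 first.
  - exact: cvg_cst.
  - by rewrite -(subrr (s' * t')); apply: cvgB => //; apply: cvgM.
  apply: nearW => n; rewrite normr_ge0/= !series_convol.
  rewrite [X in X * series b n]/series [X in X * series b' n]/series /= !mulr_suml -!sumrB.
  rewrite (le_trans (ler_norm_sum _ _ _))//; apply: ler_sum => i _.
  rewrite -!mulrBr normrM ler_wpM2l//.
  rewrite /series/= !(@big_cat_nat _ _ _ (n - i)%N 0 n)//= ?leq_subr//.
  rewrite ![_ + _ - _]addrAC !subrr !add0r.
  exact: ler_norm_sum.
rewrite -[s * t]subr0.
rewrite (_ : series _ = fun n => series a n * series b n -
    (series a n * series b n - series (convol a b) n)).
  by apply: cvgB => //; apply: cvgM.
by apply/funext => n; rewrite opprB addrC subrK.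
Qed.
End real_cauchy_product.

Section complex_cauchy_product.
Context {R : realType}.
Implicit Types (u v : nat -> R[i]) (s t : R[i]).

Definition csummable u := cvgn (series (fun n => Normc.normc (u n))).

Lemma normc_ge0 (z : R[i]) : 0 <= Normc.normc z.
Proof. by case: z => x y; exact: sqrtr_ge0. Qed.

Lemma norm_Re_le (z : R[i]) : `|complex.Re z| <= Normc.normc z.
Proof. by case: z => x y /=; rewrite -sqrtr_sqr ler_wsqrtr// lerDl sqr_ge0. Qed.

Lemma norm_Im_le (z : R[i]) : `|complex.Im z| <= Normc.normc z.
Proof. by case: z => x y /=; rewrite -sqrtr_sqr ler_wsqrtr// lerDr sqr_ge0. Qed.

Lemma csummable_Re u : csummable u -> cvgn (series (fun n => `|complex.Re (u n)|)).
Proof. by apply: series_le_cvg => // n; rewrite ?norm_Re_le// (le_trans _ (norm_Re_le _)). Qed.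

Lemma csummable_Im u : csummable u -> cvgn (series (fun n => `|complex.Im (u n)|)).
Proof. by apply: series_le_cvg => // n; rewrite ?norm_Im_le// (le_trans _ (norm_Im_le _)). Qed.

Lemma csummable_csums u : csummable u -> csums u (csum u).
Proof.
move=> us.
have [[s /= sE] [t /= tE]] : (exists s : R, series (fun n => complex.Re (u n)) @ \oo --> s)
   /\ (exists s : R, series (fun n => complex.Im (u n)) @ \oo --> s).
  split; apply/cvg_ex; apply: normed_cvg; [exact: csummable_Re|exact: csummable_Im].
have H : csums u (s +i* t) by [].
by rewrite (csumE H).
Qed.

(** Real and imaginary parts of a Cauchy product are combinations of four real
    Cauchy products. *)
Lemma csums_convol u v s t : csummable u -> csummable v ->
  csums u s -> csums v t -> csums (convol u v) (s * t).
Proof.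
move=> us vs [uR uI] [vR vI].
have [uR' uI'] := (csummable_Re us, csummable_Im us).
have [vR' vI'] := (csummable_Re vs, csummable_Im vs).
split.
- have -> : series (fun n => complex.Re (convol u v n)) =
    (fun n => series (convol (fun n => complex.Re (u n)) (fun n => complex.Re (v n))) n
      - series (convol (fun n => complex.Im (u n)) (fun n => complex.Im (v n))) n).
    apply/funext => n; rewrite /series/= -sumrB; apply: eq_bigr => i _.
    rewrite /convol raddf_sum -sumrB; apply: eq_bigr => j _.
    by case: (u j) (v _) => [? ?] [? ?].
  have -> : complex.Re (s * t) =
    complex.Re s * complex.Re t - complex.Im s * complex.Im t.
    by case: s t {uR uI vR vI} => [? ?] [? ?].
  by apply: cvgB; apply: cvg_series_convol.
- have -> : series (fun n => complex.Im (convol u v n)) =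
    (fun n => series (convol (fun n => complex.Re (u n)) (fun n => complex.Im (v n))) n
      + series (convol (fun n => complex.Im (u n)) (fun n => complex.Re (v n))) n).
    apply/funext => n; rewrite /series/= -big_split; apply: eq_bigr => i _.
    rewrite /convol raddf_sum -big_split; apply: eq_bigr => j _.
    by case: (u j) (v _) => [? ?] [? ?].
  have -> : complex.Im (s * t) =
    complex.Re s * complex.Im t + complex.Im s * complex.Re t.
    by case: s t {uR uI vR vI} => [? ?] [? ?].
  by apply: cvgD; apply: cvg_series_convol.
Qed.
End complex_cauchy_product.

(** * Euler's integral *)

Section gamma_integral.
Context {R : realType}.
Local Notation mu := (@lebesgue_measure R).
Implicit Types (a t : R).

(** The integrand of Euler's integral; up to normalisation the density of the
    Gamma distribution with shape [a]. *)
Definition gamma_density a t : R := t `^ (a - 1) * expR (- t).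

Definition gamma_integral a : \bar R :=
  (\int[mu]_(t in (`]0%R, +oo[%classic : set R)) (gamma_density a t)%:E)%E.

Lemma gamma_density_ge0 a t : 0 <= gamma_density a t.
Proof. by rewrite mulr_ge0 ?powR_ge0 ?expR_ge0. Qed.

Lemma measurable_gamma_density a (D : set R) : measurable_fun D (gamma_density a).
Proof.
apply: measurable_funTS; apply: measurable_funM => //.
by apply: measurableT_comp => //; apply: oppr_measurable.
Qed.

(** This derivative contains the two consecutive Euler integrands, so that
    integrating it gives the functional equation of Gamma. *)
Lemma is_derive_gamma_density a t : 0 < t ->
  is_derive t 1 (gamma_density (a + 1)) (a * gamma_density a t - gamma_density (a + 1) t).
Proof.
move=> t0; rewrite /gamma_density addrK.
have D1 := is_derive1_powR a t0.
apply: is_derive_eq.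
rewrite /GRing.scale/= mulrN1 mulrN; ring.
Qed.

Lemma continuous_gamma_density a t : 0 < t -> {for t, continuous (gamma_density a)}.
Proof.
move=> t0; have := is_derive_gamma_density (a - 1) t0; rewrite subrK => D.
apply: differentiable_continuous; apply/derivable1_diffP.
exact: ex_derive.
Qed.

Lemma within_continuous_gamma_density a (e n : R) : 0 < e ->
  {within `[e, n], continuous (gamma_density a)}.
Proof.
move=> e0; apply: continuous_in_subspaceT => t; rewrite inE/= in_itv/= => /andP[et _].
by apply: continuous_gamma_density; apply: lt_le_trans et.
Qed.

(** Integration by parts away from 0, where [gamma_density a] may blow up. *)
Lemma gamma_integral_truncated a (e n : R) : 0 < e -> e < n ->
  (\int[mu]_(t in `[e, n]) (gamma_density (a + 1) t)%:E =
   a%:E * \int[mu]_(t in `[e, n]) (gamma_density a t)%:E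
   - (gamma_density (a + 1) n)%:E + (gamma_density (a + 1) e)%:E)%E.
Proof.
move=> e0 en.
have C b := @within_continuous_gamma_density b e n e0.
have I b : mu.-integrable `[e, n] (EFin \o gamma_density b).
  by apply: continuous_compact_integrable => //; exact: segment_compact.
have := @continuous_FTC2 R
  (fun t => a * gamma_density a t - gamma_density (a + 1) t)
  (gamma_density (a + 1)) e n en.
have -> : (\int[mu]_(x in `[e, n]) (a * gamma_density a x - gamma_density (a + 1) x)%:E =
   a%:E * \int[mu]_(t in `[e, n]) (gamma_density a t)%:E
   - \int[mu]_(t in `[e, n]) (gamma_density (a + 1) t)%:E)%E.
  under eq_integral do rewrite EFinB EFinM.
  rewrite integralB//= ?integralZl//.
  - exact: I.
  - by apply: integrableZl => //; exact: I.
  - exact: I.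
move=> H.
have {H} H : (a%:E * (\int[mu]_(t in `[e, n]) (gamma_density a t)%:E) -
    (\int[mu]_(t in `[e, n]) (gamma_density (a + 1) t)%:E) =
    (gamma_density (a + 1) n)%:E - (gamma_density (a + 1) e)%:E)%E.
  apply: H.
  - apply: continuous_in_subspaceT => x; rewrite inE/= in_itv/= => /andP[ex _].
    have x0 := lt_le_trans e0 ex.
    by apply: cvgB; [apply: cvgMr|]; exact: continuous_gamma_density.
  - split.
    + move=> x; rewrite in_itv/= => /andP[ex _].
      by apply: ex_derive; apply: is_derive_gamma_density; apply: lt_trans ex.
    + by apply: cvg_at_right_filter; apply: continuous_gamma_density.
    + by apply: cvg_at_left_filter; apply: continuous_gamma_density; apply: lt_trans en.
  - move=> x; rewrite in_itv/= => /andP[ex _].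
    rewrite derive1E; have := is_derive_gamma_density a (lt_trans e0 ex) => D.
    by rewrite derive_val.
move: H.
have /fineK <- : (\int[mu]_(t in `[e, n]) (gamma_density a t)%:E)%E \is a fin_num.
  exact: integrable_fin_num (I a).
have /fineK <- : (\int[mu]_(t in `[e, n]) (gamma_density (a + 1) t)%:E)%E \is a fin_num.
  exact: integrable_fin_num (I (a + 1)).
rewrite -!EFinM -!EFinB -EFinD => -[H]; congr EFin.
by rewrite [fine _]/= in H *; lra.
Qed.

Lemma gamma_density_cvg0 a : 0 < a -> gamma_density (a + 1) (n.+1%:R^-1) @[n --> \oo] --> 0.
Proof.
move=> a0; rewrite /gamma_density addrK.
have H : (n.+1%:R^-1 : R) @[n --> \oo] --> 0^'+.
  move=> A [e /= e0 eA].
  have := @cvg_harmonic R => /cvgrPdist_lt /(_ e e0) [N _ NA]; exists N => // n /= Nn.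
  by apply: eA; [exact: NA|rewrite invr_gt0].
have -> : 0 = 0 * expR (- 0) :> R by rewrite mul0r.
apply: cvgM; first exact: (cvg_comp _ _ H (powR_cvg0 a0)).
have HN : (- n.+1%:R^-1 : R) @[n --> \oo] --> (- 0 : R).
  by apply: cvgN; exact: cvg_harmonic.
exact: (cvg_comp _ _ HN (@continuous_expR R _)).
Qed.

(** The exponential exceeds any monomial of degree greater than [a]. *)
Lemma gamma_density_cvgy a : 0 < a -> gamma_density (a + 1) (n.+1%:R) @[n --> \oo] --> 0.
Proof.
move=> a0; rewrite /gamma_density addrK.
(* large enough for x^m / x to dominate x^a when 1 <= x *)
pose m := (Num.truncn a).+2.
have am : a <= m%:R - 1.
  by rewrite -natr1 addrK ltW// truncnS_gt.
apply: (@squeeze_cvgr _ _ _ _ (fun=> 0) (fun n => m`!%:R * n.+1%:R^-1)).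
- apply: nearW => n; rewrite mulr_ge0 ?powR_ge0 ?expR_ge0//=.
  have n0 : 0 < n.+1%:R :> R by [].
  have H : n.+1%:R ^+ m / m`!%:R <= expR n.+1%:R :> R.
    apply: (le_trans _ (expR_ge1Dxn m.-1 (ltW n0))).
    by rewrite [X in _ + X](_ : _ = n.+1%:R ^+ m / m`!%:R)// lerDr.
  rewrite expRN ler_pdivrMr ?expR_gt0//.
  have H2 : n.+1%:R `^ a <= n.+1%:R ^+ m / n.+1%:R :> R.
    rewrite -powR_mulrn ?(ltW n0)// -[X in _ / X]powRr1 ?(ltW n0)//.
    rewrite -powRB ?pnatr_eq0 ?implybT//.
    by apply: ler_powR => //; rewrite ler1n.
  apply: (le_trans H2).
  rewrite [leRHS]mulrAC; apply: ler_wpM2r; first by rewrite invr_ge0.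
  by rewrite -ler_pdivrMl ?ltr0n ?fact_gt0// mulrC.
- exact: cvg_cst.
- by rewrite -(mulr0 m`!%:R); apply: cvgMr; exact: cvg_harmonic.
Qed.

End gamma_integral.

Section gamma_real.
Context {R : realType}.
Local Notation mu := (@lebesgue_measure R).
Local Notation Rpos := (`]0%R, +oo[%classic : set R).
Implicit Types (a t : R).

Let exhaustion (n : nat) : set R := `[n.+2%:R^-1, n.+2%:R].

Lemma bigcup_exhaustion : \bigcup_n exhaustion n = Rpos.
Proof.
apply/seteqP; split => x /=.
  move=> [n _]; rewrite /exhaustion /= !in_itv/= andbT => /andP[+ _].
  by apply: lt_le_trans; rewrite invr_gt0.
rewrite in_itv/= andbT => x0.
pose n := (Num.truncn (x + x^-1)).
have xn : x + x^-1 < n.+2%:R by rewrite (lt_trans (truncnS_gt _))// ltr_nat.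
have x'0 : 0 < x^-1 by rewrite invr_gt0.
exists n => //; rewrite /exhaustion/= in_itv/=; apply/andP; split; last lra.
by rewrite -[leRHS]invrK lef_pV2 ?posrE//; lra.
Qed.

Lemma nondecreasing_exhaustion : nondecreasing_seq exhaustion.
Proof.
move=> m n mn; apply/subsetPset => x; rewrite /exhaustion/= !in_itv/= => /andP[mx xm].
apply/andP; split; last by rewrite (le_trans xm)// ler_nat.
by rewrite (le_trans _ mx)// lef_pV2 ?posrE// ler_nat.
Qed.

Lemma cvg_gamma_integral a :
  (\int[mu]_(t in exhaustion n) (gamma_density a t)%:E)%E @[n --> \oo]
  --> gamma_integral a.
Proof.
rewrite /gamma_integral -bigcup_exhaustion; apply: ge0_nondecreasing_set_cvg_integral.
- exact: nondecreasing_exhaustion.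
- by move=> n; exact: measurable_itv.
- by move=> n; apply/measurable_EFinP; exact: measurable_gamma_density.
- by move=> n x _; rewrite lee_fin gamma_density_ge0.
Qed.

Lemma gamma_integral_ge0 a : (0 <= gamma_integral a)%E.
Proof. by apply: integral_ge0 => x _; rewrite lee_fin gamma_density_ge0. Qed.

(** Valid in the extended reals, so it can also be used to derive finiteness:
    pass to the limit in the truncated identity along compact intervals that
    exhaust the half-line. *)
Lemma gamma_integral_rec a : 0 < a -> gamma_integral (a + 1) = (a%:E * gamma_integral a)%E.
Proof.
move=> a0.
pose d n := - gamma_density (a + 1) n.+1%:R + gamma_density (a + 1) (n.+1%:R^-1).
have d0 : (d n.+1)%:E @[n --> \oo] --> (0%:E : \bar R).
  apply: cvg_EFin; first exact: nearW.
  have -> : fine \o (fun n => (d n.+1)%:E) = (fun n => d n.+1) by [].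
  have HN : - gamma_density (a + 1) n.+1%:R @[n --> \oo] --> (- 0 : R).
    by apply: cvgN; exact: gamma_density_cvgy.
  have HD : d n @[n --> \oo] --> (- 0 + 0 : R).
    by apply: cvgD => //; exact: gamma_density_cvg0.
  by rewrite oppr0 addr0 in HD; rewrite (cvg_shiftS d).
have H2 : (\int[mu]_(t in exhaustion n) (gamma_density (a + 1) t)%:E)%E @[n --> \oo]
    --> (a%:E * gamma_integral a + 0)%E.
  rewrite (_ : (fun n => _) = fun n =>
    (a%:E * (\int[mu]_(t in exhaustion n) (gamma_density a t)%:E)
     + (d n.+1)%:E)%E).
    apply: cvgeD => //; last by apply: cvgeZl => //; exact: cvg_gamma_integral.
    by rewrite fin_num_adde_defl.
  apply/funext => n; rewrite gamma_integral_truncated ?invr_gt0//.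
    by rewrite -addeA.
  by rewrite (@lt_trans _ _ 1)// ?invf_lt1// ltr1n.
rewrite -[RHS]adde0.
exact: (cvg_unique (@ereal_hausdorff R) (@cvg_gamma_integral (a + 1)) H2).
Qed.

Lemma gamma_integral1 : gamma_integral (1 : R) = 1%E.
Proof.
rewrite /gamma_integral -(@integral_exponential_pdf R 1)//.
rewrite [RHS](_ : _ =
  \int[mu]_(x in `[0%R, +oo[%classic) (expR (- x))%:E)%E; last first.
  rewrite [RHS]integral_mkcond; apply: eq_integral => x _.
  by rewrite /exponential_pdf !patchE; case: ifPn => // _; rewrite mul1r mulN1r.
rewrite -integral_itv_obnd_cbnd; last first.
  apply/measurable_EFinP; apply: measurable_funTS; exact: measurableT_comp.
by apply: eq_integral => x _; rewrite /gamma_density subrr powRr0 mul1r.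
Qed.

Lemma gamma_integral_nat_lty n : (gamma_integral (n.+1%:R : R) < +oo)%E.
Proof.
elim: n => [|n IH]; first by rewrite gamma_integral1 ltry.
rewrite -natr1 gamma_integral_rec//.
by rewrite lte_mul_pinfty// lee_fin.
Qed.

(** For [n <= a - 1 < n + 1] the power [x^(a - 1)] is at most [x^n] on [0, 1] and
    at most [x^(n + 1)] beyond, and Euler's integral is finite at positive
    integers by the functional equation. *)
Lemma gamma_integral_lty_ge1 a : 1 <= a -> (gamma_integral a < +oo)%E.
Proof.
move=> a1.
have a0 : 0 <= a - 1 by lra.
pose n := Num.truncn (a - 1).
have /andP[na an] := truncn_itv a0; rewrite -/n in na an.
apply: (@le_lt_trans _ _ (gamma_integral n.+1%:R + gamma_integral n.+2%:R)%E); last first.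
  by rewrite lte_add_pinfty// gamma_integral_nat_lty.
rewrite /gamma_integral -ge0_integralD//=; last 4 first.
- by move=> x _; rewrite lee_fin gamma_density_ge0.
- by apply/measurable_EFinP; exact: measurable_gamma_density.
- by move=> x _; rewrite lee_fin gamma_density_ge0.
- by apply/measurable_EFinP; exact: measurable_gamma_density.
apply: ge0_le_integral => //=.
- by move=> x _; rewrite lee_fin gamma_density_ge0.
- by apply/measurable_EFinP; exact: measurable_gamma_density.
- by apply: emeasurable_funD; apply/measurable_EFinP; exact: measurable_gamma_density.
move=> x; rewrite in_itv/= andbT => x0.
rewrite -EFinD lee_fin /gamma_density -mulrDl ler_pM2r ?expR_gt0//.
rewrite -natr1 addrK -natr1 addrK.
have [x1|x1] := leP x 1.
- by rewrite (@le_trans _ _ (x `^ n%:R))// ?lerDl ?powR_ge0// ger_powR// x0.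
- by rewrite (@le_trans _ _ (x `^ n.+1%:R))// ?lerDr ?powR_ge0// ler_powR// ltW.
Qed.

(** The functional equation reduces [0 < a] to the case [1 <= a]. *)
Lemma gamma_integral_lty a : 0 < a -> (gamma_integral a < +oo)%E.
Proof.
move=> a0.
have : (gamma_integral (a + 1) < +oo)%E by apply: gamma_integral_lty_ge1; lra.
rewrite gamma_integral_rec//; have := gamma_integral_ge0 a.
by case: (gamma_integral a) => [r| |]//= _; rewrite ?ltry// mulry gtr0_sg// mul1e ltxx.
Qed.

(** On [1, 2] the integrand is at least [e^(-2)]. *)
Lemma gamma_integral_gt0_ge1 a : 1 <= a -> (0 < gamma_integral a)%E.
Proof.
move=> a1.
apply: (@lt_le_trans _ _ (expR (- 2))%:E); first by rewrite lte_fin expR_gt0.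
apply: (@le_trans _ _
  (\int[mu]_(t in `[1%R, 2%R]%classic) (gamma_density a t)%:E)%E); last first.
  apply: ge0_subset_integral => //=.
  - by apply/measurable_EFinP; exact: measurable_gamma_density.
  - by move=> x _; rewrite lee_fin gamma_density_ge0.
  - by move=> x /=; rewrite !in_itv/= andbT => /andP[/(lt_le_trans _)->].
apply: (@le_trans _ _ (\int[mu]_(t in `[1%R, 2%R]%classic) (expR (- 2))%:E)%E).
  rewrite integral_cst//= lebesgue_measure_itv/= lte_fin ltr1n -EFinB -EFinM lee_fin.
  by rewrite ler_peMr ?expR_ge0//; lra.
apply: ge0_le_integral => //=.
- by apply/measurable_EFinP; exact: measurable_gamma_density.
move=> x; rewrite in_itv/= => /andP[x1 x2]; rewrite lee_fin /gamma_density.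
rewrite (@le_trans _ _ (expR (- x)))//; first by rewrite ler_expR; lra.
by rewrite ler_peMl ?expR_ge0// -[leLHS](powRr0 x) ler_powR//; lra.
Qed.

Lemma gamma_integral_gt0 a : 0 < a -> (0 < gamma_integral a)%E.
Proof.
move=> a0.
have : (0 < gamma_integral (a + 1))%E by apply: gamma_integral_gt0_ge1; lra.
by rewrite gamma_integral_rec// pmule_rgt0.
Qed.

Definition euler_gamma a : R := fine (gamma_integral a).

Lemma euler_gamma_rec a : 0 < a -> euler_gamma (a + 1) = a * euler_gamma a.
Proof.
move=> a0; rewrite /euler_gamma gamma_integral_rec// fineM//.
by rewrite ge0_fin_numE ?gamma_integral_ge0// gamma_integral_lty.
Qed.

Lemma euler_gamma_gt0 a : 0 < a -> 0 < euler_gamma a.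
Proof. by move=> a0; rewrite fine_gt0// gamma_integral_gt0//= gamma_integral_lty. Qed.

Lemma integrable_gamma_density a : 0 < a ->
  mu.-integrable Rpos (EFin \o gamma_density a).
Proof.
move=> a0; apply/integrableP; split.
  by apply/measurable_EFinP; exact: measurable_gamma_density.
under eq_integral do rewrite /= ger0_norm ?gamma_density_ge0//.
exact: gamma_integral_lty.
Qed.

End gamma_real.

(** * Pochhammer symbols and the Gamma function *)

Section pochhammer.
Context {K : comNzRingType}.
Implicit Types (a c : K).

Definition poch a (n : nat) : K := \prod_(i < n) (a + i%:R).

Lemma poch0 a : poch a 0 = 1.
Proof. by rewrite /poch big_ord0. Qed.

Lemma pochSr a n : poch a n.+1 = poch a n * (a + n%:R).
Proof. by rewrite /poch big_ord_recr. Qed.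

Lemma pochS a n : poch a n.+1 = a * poch (a + 1) n.
Proof.
rewrite /poch big_ord_recl/= addr0; congr (_ * _); apply: eq_bigr => i _.
by rewrite -addrA -mulrS.
Qed.

Lemma pochD a m n : poch a (m + n) = poch a m * poch (a + m%:R) n.
Proof.
elim: n => [|n IH]; first by rewrite addn0 poch0 mulr1.
by rewrite addnS !pochSr IH natrD mulrA addrA.
Qed.

(** Chu-Vandermonde summation, cleared of denominators.  Pascal's rule splits
    the sum for [m + 1] into [c + m] times the sum for [(a, c)] and [- a] times
    the sum for [(a + 1, c + 1)]; both equal [(c - a)_m]. *)
Lemma poch_vandermonde a c m :
  \sum_(j < m.+1) 'C(m, j)%:R * ((-1) ^+ j * poch a j * poch (c + j%:R) (m - j))
  = poch (c - a) m.
Proof.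
elim: m a c => [|m IH] a c.
  by rewrite big_ord_recl big_ord0 /= bin0 !poch0 expr0 !mulr1 addr0.
rewrite big_ord_recl /= bin0 expr0 poch0 !mul1r addr0 subn0.
under eq_bigr => i _.
  rewrite /bump/= add1n binS natrD mulrDl subSS.
  over.
rewrite big_split/= addrA.
have -> : poch c m.+1 + \sum_(i < m.+1) 'C(m, i.+1)%:R *
    ((-1) ^+ i.+1 * poch a i.+1 * poch (c + i.+1%:R) (m - i)) = (c + m%:R) * poch (c - a) m.
  rewrite big_ord_recr/= bin_small// mul0r addr0 -IH mulr_sumr.
  rewrite [RHS]big_ord_recl/= bin0 expr0 poch0 !mul1r addr0 subn0 pochSr mulrC; congr (_ + _).
  apply: eq_bigr => i _; rewrite /bump/= add1n.
  have im := ltn_ord i.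
  have -> : (m - i = (m - i.+1).+1)%N by lia.
  rewrite (pochSr (c + _)); have -> : c + i.+1%:R + (m - i.+1)%:R = c + m%:R.
    by rewrite -addrA -natrD subnKC.
  by ring.
have -> : \sum_(i < m.+1) 'C(m, i)%:R *
    ((-1) ^+ i.+1 * poch a i.+1 * poch (c + i.+1%:R) (m - i)) = - a * poch (c - a) m.
  rewrite (_ : c - a = (c + 1) - (a + 1)); last by ring.
  rewrite -IH mulr_sumr; apply: eq_bigr => i _.
  have -> : c + i.+1%:R = c + 1 + i%:R by rewrite -addrA -mulrS.
  rewrite pochS exprS; ring.
by rewrite pochSr -mulrDl mulrC; congr (_ * _); ring.
Qed.

End pochhammer.

Definition pole_shift {R : realType} (x : R) : nat := (Num.truncn `|x|).+1.

(** Euler's integral continued to the left by the functional equation.  At a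
    pole the Pochhammer symbol is 0, hence the value is 0, and the reciprocal is
    the entire function 1/Gamma on the whole real line.  The definition is locked
    because unification would otherwise see a quotient in every occurrence. *)
HB.lock Definition Gamma {R : realType} (x : R) : R :=
  euler_gamma (x + (pole_shift x)%:R) / poch x (pole_shift x).
Canonical Gamma_unlockable := Unlockable Gamma.unlock.

Section gamma_function.
Context {R : realType}.
Implicit Types (a t x : R).

Lemma poch_gt0 x n : 0 < x -> 0 < poch x n.
Proof. by move=> x0; apply: prodr_gt0 => i _; rewrite ltr_pwDl. Qed.

Lemma euler_gammaD x n : 0 < x -> euler_gamma (x + n%:R) = poch x n * euler_gamma x.
Proof.
move=> x0; elim: n => [|n IH]; first by rewrite addr0 poch0 mul1r.
by rewrite -natr1 addrA euler_gamma_rec ?ltr_wpDr// IH pochSr; ring.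
Qed.

Lemma pole_shift_gt x : 0 < x + (pole_shift x)%:R.
Proof.
have := truncnS_gt `|x|; rewrite -/(pole_shift x).
by have := lerNnormlW (lexx `|x|); lra.
Qed.

(** The continuation does not depend on the number of steps, since further
    steps multiply numerator and denominator by the same positive factor. *)
Lemma GammaE x n : 0 < x + n%:R -> Gamma x = euler_gamma (x + n%:R) / poch x n.
Proof.
have H m p : 0 < x + m%:R ->
    euler_gamma (x + (m + p)%:R) / poch x (m + p) =
    euler_gamma (x + m%:R) / poch x m.
  move=> xm; rewrite natrD addrA (@euler_gammaD (x + m%:R))// pochD [poch x m * _]mulrC.
  by rewrite -mulf_div divff ?mul1r// gt_eqF// poch_gt0.
move=> xn; have xo := pole_shift_gt x; rewrite unlock.
by rewrite -(H _ n xo) addnC H.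
Qed.

Lemma Gamma_posE x : 0 < x -> Gamma x = euler_gamma x.
Proof. by move=> x0; rewrite (@GammaE x 0) ?addr0// poch0 divr1. Qed.

Lemma Gamma_gt0 x : 0 < x -> 0 < Gamma x.
Proof. by move=> x0; rewrite Gamma_posE// euler_gamma_gt0. Qed.

(** Holds at the poles as well: this is the functional equation of the entire
    function 1/Gamma. *)
Lemma GammaV_rec x : (Gamma x)^-1 = x * (Gamma (x + 1))^-1.
Proof.
have x1 := pole_shift_gt (x + 1).
rewrite (GammaE x1) (@GammaE x (pole_shift (x + 1)).+1) -natr1; last by rewrite addrA addrAC.
by rewrite !invf_div pochS -addrA [1 + _]addrC mulrA.
Qed.

Lemma GammaV_poch x n : (Gamma x)^-1 = poch x n * (Gamma (x + n%:R))^-1.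
Proof.
elim: n => [|n IH]; first by rewrite poch0 mul1r addr0.
by rewrite IH GammaV_rec pochSr -addrA natr1 mulrA.
Qed.

Lemma Gamma_poch x n : 0 < x -> Gamma (x + n%:R) = poch x n * Gamma x.
Proof. by move=> x0; rewrite !Gamma_posE ?euler_gammaD// ltr_wpDr. Qed.

Lemma Gamma_neq0 x : ~ gamma_pole x -> Gamma x != 0.
Proof.
move=> np; rewrite -invr_eq0 (GammaV_poch _ (pole_shift x)) mulf_neq0//; last first.
  by rewrite invr_neq0// gt_eqF// Gamma_gt0// pole_shift_gt.
apply/prodf_neq0 => i _; apply/negP => /eqP xi; apply: np; exists i.
by apply/eqP; rewrite -addr_eq0 xi.
Qed.

Lemma normc_real x : Normc.normc (x%:C) = `|x|.
Proof. by rewrite /= expr0n addr0 sqrtr_sqr. Qed.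

Lemma clog_pos x : 0 < x -> clog x%:C = (ln x)%:C.
Proof.
by move=> x0; rewrite /clog /carg normc_real gtr0_norm//= lexx divff ?gt_eqF// acos1.
Qed.

Lemma cexp_real x : cexp x%:C = (expR x)%:C.
Proof. by rewrite /cexp /= cos0 sin0 mulr1 mulr0. Qed.

Lemma cpow_real x a : 0 < x -> cpow x%:C a%:C = (x `^ a)%:C.
Proof.
move=> x0; rewrite /cpow /powR (inj_eq (@complexI _) x 0) gt_eqF//.
by rewrite clog_pos// -rmorphM cexp_real.
Qed.

Lemma eq_cintegral (D : set R) (f g : R -> R[i]) : {in D, f =1 g} ->
  cintegral D f = cintegral D g.
Proof. by move=> fg; congr (_ +i* _); apply: eq_Rintegral => x /fg ->. Qed.

Lemma euler_integral_real x : euler_integral x%:C = (euler_gamma x)%:C.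
Proof.
rewrite /euler_integral (@eq_cintegral _ _ (fun t => (gamma_density x t)%:C)).
  by rewrite /cintegral/=; congr (_ +i* _); rewrite Rintegral_cst//= mul0r.
move=> t; rewrite inE/= in_itv/= andbT => t0.
by rewrite -[1]/(1%:C) -rmorphB cpow_real// -rmorphM.
Qed.

Lemma cpoch_real x n : cpoch x%:C n = (poch x n)%:C.
Proof. by rewrite rmorph_prod; apply: eq_bigr => i _; rewrite rmorphD rmorph_nat. Qed.

Lemma cGamma_real x : cGamma x%:C = (Gamma x)%:C.
Proof.
rewrite /cGamma /= cpoch_real -[(_).+1%:R](rmorph_nat (real_complex R)) -rmorphD.
by rewrite euler_integral_real -fmorph_div unlock.
Qed.

End gamma_function.

(** * Integrating a series term by term *)

Section integral_of_series.
Context d (T : measurableType d) (R : realType) (mu : {measure set T -> \bar R}).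
Variables (D : set T) (mD : measurable D).

(** The pointwise sum of the absolute values is integrable by monotone
    convergence and dominates all partial sums. *)
Lemma integral_series (g : nat -> T -> R) (f : T -> R) :
  (forall n, mu.-integrable D (EFin \o g n)) ->
  cvgn (series (fun n => \int[mu]_(x in D) `|g n x|)) ->
  (forall x, D x -> series (g^~ x) @ \oo --> f x) ->
  mu.-integrable D (EFin \o f) /\
  series (fun n => \int[mu]_(x in D) g n x) @ \oo --> \int[mu]_(x in D) f x.
Proof.
move=> ig cg gf.
have mg n : measurable_fun D (g n) by apply/measurable_EFinP; exact: measurable_int (ig n).
have mng n : measurable_fun D (fun x => `|g n x|) by apply: measurableT_comp.
pose G x := (\sum_(n <oo) `|g n x|%:E)%E.
have iG : mu.-integrable D G.
  apply/integrableP; split.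
    by apply: ge0_emeasurable_sum => // n _; apply/measurable_EFinP.
  have -> : (\int[mu]_(x in D) `|G x| = \int[mu]_(x in D) G x)%E.
    apply: eq_integral => x _; rewrite gee0_abs//.
    by apply: nneseries_ge0 => n _ _; rewrite lee_fin.
  rewrite integral_nneseries//; last by move=> n; apply/measurable_EFinP.
  rewrite (eq_eseriesr (g := fun n => (\int[mu]_(x in D) `|g n x|)%:E)).
    pose I n := \int[mu]_(x in D) `|g n x|.
    rewrite (_ : limn _ = (limn (series I))%:E) ?ltry//.
    apply: cvg_lim => //; rewrite (_ : (fun n => _) = EFin \o series I).
      by apply: cvg_EFin; [exact: nearW|exact: cg].
    by apply/funext => n; rewrite /series/= sumEFin.
  move=> n _; rewrite fineK//; apply: integrable_fin_num => //.
  exact: integrable_norm (ig n).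
pose S N x := (series (g^~ x) N)%:E.
have mf : measurable_fun D f.
  apply: (measurable_fun_cvg (f := f) (h := fun N x => series (g^~ x) N)).
    by move=> N; apply: measurable_sum.
  by move=> x /gf.
have [|||||If _ cf] := @dominated_convergence _ T R mu D mD S (EFin \o f) G.
- by move=> N; apply/measurable_EFinP; exact: measurable_sum.
- exact/measurable_EFinP.
- by apply: aeW => x Dx; apply: cvg_EFin; [exact: nearW|exact: gf].
- by [].
- apply: aeW => x N Dx; rewrite /S /G.
  apply: (@le_trans _ _ (\sum_(0 <= n < N) `|g n x|%:E)%E).
    by rewrite sumEFin [leLHS]/= lee_fin ler_norm_sum.
  by apply: nneseries_lim_ge => n _; rewrite lee_fin.
split=> //.
have E N : (series (fun n => \int[mu]_(x in D) g n x) N)%:E =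
    (\int[mu]_(x in D) S N x)%E.
  rewrite /S /series/= -sumEFin.
  under [RHS]eq_integral do rewrite -sumEFin.
  rewrite integral_sum//; apply: eq_bigr => i _; rewrite fineK//.
  by apply: integrable_fin_num => //; exact: ig.
move: cf; rewrite (_ : [sequence _]_n =
    EFin \o series (fun n => \int[mu]_(x in D) g n x)); last first.
  by apply/funext => N /=; rewrite E.
rewrite -[X in _ --> X]fineK; first by move/fine_cvg.
exact: integrable_fin_num If.
Qed.
End integral_of_series.

Section complex_integral_of_series.
Context {R : realType}.
Local Notation mu := (@lebesgue_measure R).
Variables (D : set (measurableTypeR R)) (mD : measurable D).

(** Complex coefficients in front of real functions; the bounds [B] on the L1
    norms spare computing these norms exactly. *)
Lemma cintegral_series (u : nat -> R[i]) (p : nat -> R -> R)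
    (B : nat -> R) (f : R -> R[i]) :
  (forall n, mu.-integrable D (EFin \o p n)) ->
  (forall n, \int[mu]_(x in D) `|p n x| <= B n) ->
  cvgn (series (fun n => Normc.normc (u n) * B n)) ->
  (forall x, D x -> csums (fun n => u n * (p n x)%:C) (f x)) ->
  cintegrable D f /\
  csums (fun n => u n * (\int[mu]_(x in D) p n x)%:C) (cintegral D f).
Proof.
move=> ip pB uB uf.
have Z (c : R) n : mu.-integrable D (EFin \o (fun x => c * p n x)).
  by have := integrableZl mD c (ip n).
have C (c : nat -> R) (h : R -> R) :
    (forall n, `|c n| <= Normc.normc (u n)) ->
    (forall x, D x -> series (fun n => c n * p n x) @ \oo --> h x) ->
    mu.-integrable D (EFin \o h) /\
    series (fun n => c n * \int[mu]_(x in D) p n x) @ \oo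
      --> \int[mu]_(x in D) h x.
  move=> cu ch.
  have [|||ih] := @integral_series _ _ R mu D mD (fun n x => c n * p n x) h.
  - by move=> n; exact: Z.
  - apply: series_le_cvg uB => n.
    + exact: Rintegral_ge0.
    + by apply: mulr_ge0; [exact: normc_ge0|rewrite (le_trans _ (pB n))// Rintegral_ge0].
    + rewrite (_ : \int[mu]_(x in D) _ = `|c n| * \int[mu]_(x in D) `|p n x|).
        by rewrite ler_pM// Rintegral_ge0.
      rewrite -RintegralZl//; last exact: integrable_norm (ip n).
      by apply: eq_Rintegral => x _; rewrite normrM.
  - exact: ch.
  split=> //.
  rewrite (_ : (fun n => c n * _) = fun n => \int[mu]_(x in D) (c n * p n x))//.
  by apply/funext => n; rewrite RintegralZl.
have ReZ (z : R[i]) (r : R) : complex.Re (z * r%:C) = complex.Re z * r.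
  by case: z => a b /=; rewrite mulr0 subr0.
have ImZ (z : R[i]) (r : R) : complex.Im (z * r%:C) = complex.Im z * r.
  by case: z => a b /=; rewrite mulr0 add0r.
have [||IR CR] := C (fun n => complex.Re (u n)) (fun x => complex.Re (f x)).
- by move=> n; exact: norm_Re_le.
- by move=> x /uf[+ _]; under eq_fun do rewrite ReZ.
have [||II CI] := C (fun n => complex.Im (u n)) (fun x => complex.Im (f x)).
- by move=> n; exact: norm_Im_le.
- by move=> x /uf[_ +]; under eq_fun do rewrite ImZ.
split; first by [].
split.
  by rewrite /cintegral/=; under eq_fun do rewrite ReZ.
by rewrite /cintegral/=; under eq_fun do rewrite ImZ.
Qed.
End complex_integral_of_series.

(** * Ratio test and the exponential series *)

Section ratio_test.
Context {R : realType}.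

(** Such a sequence is dominated by a multiple of [K^n / n!]. *)
Lemma cvg_series_fact_ratio (v : nat -> R) (K : R) (N : nat) :
  (forall n, 0 <= v n) -> 0 < K ->
  (forall n, (N <= n)%N -> v n.+1 * n.+1%:R <= K * v n) -> cvgn (series v).
Proof.
move=> v0 K0 vK.
have b0 i : 0 <= v i * i`!%:R / K ^+ i by rewrite divr_ge0// ?exprn_ge0// ?mulr_ge0// ltW.
(* bounds v n * n! / K^n for n <= N term by term, and beyond N by the ratio *)
pose C := \sum_(i < N.+1) v i * i`!%:R / K ^+ i.
have bC n : v n * n`!%:R / K ^+ n <= C.
  elim: n => [|n IH].
    by rewrite /C big_ord_recl/= lerDl sumr_ge0.
  have [nN|Nn] := ltnP n N.
    have nN' : (n.+1 < N.+1)%N by [].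
    by rewrite /C (bigD1 (Ordinal nN'))//= lerDl sumr_ge0.
  apply: le_trans IH; rewrite factS natrM exprS invfM !mulrA ler_pM2r ?invr_gt0 ?exprn_gt0//.
  rewrite mulrAC ler_wpM2r ?ler0n//.
  by rewrite ler_pdivrMr// [leRHS]mulrC vK.
apply: (@series_le_cvg _ _ (fun n => C * exp_coeff K n)) => //.
- by move=> n; rewrite mulr_ge0 ?sumr_ge0// exp_coeff_ge0// ltW.
- move=> n; have := bC n; rewrite ler_pdivrMr ?exprn_gt0// /exp_coeff/= mulrA.
  by rewrite -ler_pdivlMr ?ltr0n ?fact_gt0.
- apply: is_cvg_seriesZ; exact: is_cvg_series_exp_coeff.
Qed.

(** The shape of all convergence questions below: once [y + n >= 1], the ratio
    [(x + n) / (y + n)] is bounded and the factor [n + 1] makes the series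
    converge like an exponential series. *)
Lemma cvg_series_hypergeom_ratio (v : nat -> R) (t x y : R) :
  (forall n, 0 <= v n) -> 0 <= t -> 0 <= x ->
  (forall n, v n.+1 * n.+1%:R * `|y + n%:R| <= t * (x + n%:R) * v n) ->
  cvgn (series v).
Proof.
move=> v0 t0 x0 vt.
(* the last summand 1 only makes K positive when t = 0 *)
pose K := t * (x + `|y| + 1) + 1.
have K0 : 0 < K by rewrite ltr_wpDl// mulr_ge0// !addr_ge0.
apply: (@cvg_series_fact_ratio v K (Num.truncn `|y|).+2 v0 K0) => n Nn.
have yn : 1 <= y + n%:R.
  have : `|y| + 1 <= n%:R.
    apply: (@le_trans _ _ (Num.truncn `|y|).+2%:R); last by rewrite ler_nat.
    by rewrite -natr1 lerD2r ltW// truncnS_gt.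
  by have := lerNnormlW (lexx `|y|); lra.
have := vt n; rewrite ger0_norm; last by lra.
move=> vtn; rewrite -(@ler_pM2r _ (y + n%:R)); last by lra.
apply: (le_trans vtn).
rewrite [leRHS]mulrAC ler_wpM2r//.
have := normr_ge0 y; have := ler_norm y; have := lerNnormlW (lexx `|y|).
rewrite /K => h1 h2 h3.
have h4 : x + n%:R <= (x + `|y| + 1) * (y + n%:R) by nra.
have : t * (x + n%:R) <= t * ((x + `|y| + 1) * (y + n%:R)) by rewrite ler_wpM2l.
by lra.
Qed.
End ratio_test.

Section complex_exponential.
Context {R : realType}.
Implicit Types (z w : R[i]).

Lemma normcX z n : Normc.normc (z ^+ n) = Normc.normc z ^+ n.
Proof.
elim: n => [|n IH]; first by rewrite !expr0 Normc.normc1.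
by rewrite !exprS Normc.normcM IH.
Qed.

Lemma normc_nat n : Normc.normc (n%:R : R[i]) = n%:R.
Proof. by rewrite -(rmorph_nat (real_complex R)) normc_real ger0_norm. Qed.

Definition cexp_coeff z : nat -> R[i] := fun n => z ^+ n / n`!%:R.

Lemma csummable_cexp_coeff z : csummable (cexp_coeff z).
Proof.
rewrite /csummable (_ : (fun n => _) = exp_coeff (Normc.normc z)).
  exact: is_cvg_series_exp_coeff.
by apply/funext => n; rewrite /exp_coeff/= Normc.normcM normcX Normc.normcV normc_nat.
Qed.

Lemma cexp_coeffD z w n : convol (cexp_coeff z) (cexp_coeff w) n = cexp_coeff (w + z) n.
Proof.
rewrite /convol /cexp_coeff exprDn mulr_suml; apply: eq_bigr => i _.
have iN : (i <= n)%N by rewrite -ltnS ltn_ord.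
rewrite -(bin_fact iN) -mulr_natr !natrM.
have fE (m : nat) : m`!%:R != 0 :> R[i] by rewrite pnatr_eq0 -lt0n fact_gt0.
have := fE i; have := fE (n - i)%N.
have : 'C(n, i)%:R != 0 :> R[i] by rewrite pnatr_eq0 -lt0n bin_gt0.
by move=> h1 h2 h3; field; rewrite h1 h2 h3.
Qed.

(** Separates even and odd powers in the shape of the coefficients of the cosine
    and sine series. *)
Lemma expr_imaginary (y : R) n : (0 +i* y : R[i]) ^+ n =
  ((~~ odd n)%:R * (-1) ^+ n./2 * y ^+ n) +i* ((odd n)%:R * (-1) ^+ n.-1./2 * y ^+ n).
Proof.
suff [] : (0 +i* y : R[i]) ^+ n =
  ((~~ odd n)%:R * (-1) ^+ n./2 * y ^+ n) +i* ((odd n)%:R * (-1) ^+ n.-1./2 * y ^+ n) /\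
  (0 +i* y : R[i]) ^+ n.+1 =
  ((~~ odd n.+1)%:R * (-1) ^+ n.+1./2 * y ^+ n.+1) +i*
  ((odd n.+1)%:R * (-1) ^+ n./2 * y ^+ n.+1) by [].
elim: n => [|n [IH1 IH2]].
  by split; rewrite ?expr0 ?expr1/= ?mulr1 ?mul0r ?mul1r.
split=> //.
rewrite 2!exprS IH1 /= negbK.
apply/eqP; rewrite eq_complex/=; apply/andP; split; apply/eqP.
  by rewrite !mul0r !sub0r add0r; rewrite !exprS; ring.
rewrite negbK; case: n {IH1 IH2} => [|n]; first by rewrite /=; ring.
by rewrite /= !exprS; ring.
Qed.

(** The exponential series on the two axes gives the real exponential, and cosine
    with sine; the Cauchy product of the two series gives the general case. *)
Lemma csums_cexp z : csums (cexp_coeff z) (cexp z).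
Proof.
case: z => x y.
have Ei : csums (cexp_coeff (0 +i* y)) (cos y +i* sin y).
  have E n : cexp_coeff (0 +i* y) n = cos_coeff y n +i* sin_coeff y n.
    rewrite /cexp_coeff expr_imaginary -(rmorph_nat (real_complex R)) -fmorphV.
    rewrite /cos_coeff /sin_coeff/=; apply/eqP.
    by rewrite eq_complex/= !mulr0 subr0 add0r !eqxx.
  split => /=.
    under eq_fun do rewrite E /=.
    by rewrite unlock; exact: is_cvg_series_cos_coeff.
  under eq_fun do rewrite E /=.
  by rewrite unlock; exact: is_cvg_series_sin_coeff.
have Er : csums (cexp_coeff x%:C) (expR x)%:C.
  have E n : cexp_coeff x%:C n = (exp_coeff x n)%:C.
    by rewrite /cexp_coeff /exp_coeff/= rmorphM rmorphXn fmorphV rmorph_nat.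
  split => /=.
    under eq_fun do rewrite E /=.
    exact: is_cvg_series_exp_coeff.
  under eq_fun do rewrite E /=.
  rewrite (_ : series _ = cst 0); first exact: cvg_cst.
  by apply/funext => n; rewrite /series/= big1.
have := csums_convol (@csummable_cexp_coeff _) (@csummable_cexp_coeff _) Ei Er.
have -> : (cos y +i* sin y) * (expR x)%:C = cexp (x +i* y).
  by apply/eqP; rewrite eq_complex/=; apply/andP; split; apply/eqP; ring.
apply: eq_csums => n; rewrite cexp_coeffD; congr cexp_coeff.
by apply/eqP; rewrite eq_complex/= addr0 add0r !eqxx.
Qed.
End complex_exponential.

(** * Principal logarithms and powers *)

Section complex_powers.
Context {R : realType}.
Implicit Types (z w : R[i]) (x a : R).
Local Notation normc := Normc.normc.

Lemma cexpD z w : cexp (z + w) = cexp z * cexp w.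
Proof.
case: z w => a b [c d]; rewrite /cexp/= expRD cosD sinD.
by apply/eqP; rewrite eq_complex/=; apply/andP; split; apply/eqP; ring.
Qed.

Lemma cexp0 : cexp 0 = 1 :> R[i].
Proof. by rewrite /cexp/= expR0 cos0 sin0 mulr1 mulr0. Qed.

Lemma cexpMn n z : cexp (n%:R * z) = cexp z ^+ n.
Proof.
elim: n => [|n IH]; first by rewrite mul0r cexp0.
by rewrite exprS -IH -natr1 mulrDl mul1r addrC cexpD.
Qed.

Lemma normc_gt0 z : z != 0 -> 0 < normc z.
Proof.
move=> z0; rewrite lt_neqAle normc_ge0 andbT eq_sym.
by apply: contra z0 => /eqP /Normc.eq0_normc ->.
Qed.

Lemma normc_sqr z : normc z ^+ 2 = complex.Re z ^+ 2 + complex.Im z ^+ 2.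
Proof. by case: z => a b /=; rewrite sqr_sqrtr// addr_ge0// sqr_ge0. Qed.

Lemma Re_normc_itv z : z != 0 -> -1 <= complex.Re z / normc z <= 1.
Proof.
move=> z0; have n0 := normc_gt0 z0.
rewrite ler_pdivlMr// ler_pdivrMr// mul1r mulN1r -ler_norml.
exact: norm_Re_le.
Qed.

Lemma cexp_clog z : z != 0 -> cexp (clog z) = z.
Proof.
move=> z0; have n0 := normc_gt0 z0; have I := Re_normc_itv z0.
have cE : normc z * cos (carg z) = complex.Re z.
  have -> : cos (carg z) = complex.Re z / normc z.
    by rewrite /carg; case: ifP => _; rewrite ?cosN acosK.
  by rewrite mulrC divfK// gt_eqF.
have sE : normc z * sin (carg z) = complex.Im z.
  have H : sin (acos (complex.Re z / normc z)) = `|complex.Im z| / normc z.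
    rewrite sin_acos//.
    have -> : 1 - (complex.Re z / normc z) ^+ 2 = (complex.Im z / normc z) ^+ 2.
      have -> : 1 = normc z ^+ 2 / normc z ^+ 2 :> R by rewrite divff// gt_eqF// exprn_gt0.
      by rewrite !expr_div_n -mulrBl normc_sqr addrAC subrr add0r.
    by rewrite sqrtr_sqr normf_div (gtr0_norm n0).
  rewrite /carg; case: ifP => [b0|/negbT]; rewrite ?sinN H.
    by rewrite ger0_norm// mulrC divfK// gt_eqF.
  by rewrite -ltNge => b0; rewrite ltr0_norm// mulrN mulrC divfK ?opprK// gt_eqF.
rewrite /cexp /clog/= lnK ?posrE// cE sE.
by case: z {z0 n0 I cE sE}.
Qed.

Lemma carg_scale z x : 0 < x -> z != 0 -> carg (z * x%:C) = carg z.
Proof.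
move=> x0 z0; have n0 := normc_gt0 z0.
have R1 : complex.Re (z * x%:C) = complex.Re z * x.
  by case: z {z0 n0} => a b /=; rewrite mulr0 subr0.
have I1 : complex.Im (z * x%:C) = complex.Im z * x.
  by case: z {z0 n0 R1} => a b /=; rewrite mulr0 add0r.
rewrite /carg I1 R1 Normc.normcM normc_real gtr0_norm// pmulr_lge0//.
by rewrite -mulf_div divff ?mulr1// gt_eqF.
Qed.

Lemma clog_scale z x : 0 < x -> z != 0 -> clog (z * x%:C) = clog z + (ln x)%:C.
Proof.
move=> x0 z0; rewrite /clog carg_scale// Normc.normcM normc_real gtr0_norm//.
by rewrite lnM ?posrE ?normc_gt0//; apply/eqP; rewrite eq_complex/= addr0 !eqxx.
Qed.

(** On this half of the plane the argument lies in the interval from [- pi/2]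
    (excluded) to [pi/2], so doubling it stays in the principal range. *)
Lemma clog_sqr w : w != 0 -> 0 <= complex.Re w ->
  (complex.Re w = 0 -> 0 <= complex.Im w) -> clog (w ^+ 2) = 2 * clog w.
Proof.
move=> w0 c0 cd0; have n0 := normc_gt0 w0; have I := Re_normc_itv w0.
set t := acos (complex.Re w / normc w).
have ct : cos t = complex.Re w / normc w by rewrite acosK.
have t0 : 0 <= t by exact: acos_ge0.
have tpi : t <= pi by exact: acos_lepi.
have tpi2 : t <= pi / 2.
  rewrite leNgt; apply/negP => tl.
  have : cos t < cos (pi / 2).
    have tI : t \in `[0, pi] by rewrite in_itv/= t0 tpi.
    have pI : (pi / 2 : R) \in `[0, pi].
      by rewrite in_itv/=; have := @pi_gt0 R => ?; apply/andP; split; lra.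
    by rewrite ltr_cos.
  by rewrite cos_pihalf ct ltNge divr_ge0// ltW.
have R2 : complex.Re (w ^+ 2) / normc (w ^+ 2) = cos (2 * t).
  rewrite mulr_natl cos_mulr2n ct normcX expr_div_n normc_sqr.
  have : complex.Re w ^+ 2 + complex.Im w ^+ 2 != 0 by rewrite -normc_sqr gt_eqF// exprn_gt0.
  have -> : complex.Re (w ^+ 2) = complex.Re w ^+ 2 - complex.Im w ^+ 2.
    by case: (w) => a b /=; rewrite !expr2.
  by move=> h; field.
have I2 : complex.Im (w ^+ 2) = complex.Re w * complex.Im w *+ 2.
  by case: (w) => a b /=; rewrite mulr2n [b * a]mulrC.
have cE : carg (w ^+ 2) = 2 * carg w.
  rewrite /carg R2 -/t I2 pmulrn_lge0// cosK; last first.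
    by rewrite in_itv/=; apply/andP; split; lra.
  have [d0|d0] := leP 0 (complex.Im w); first by rewrite mulr_ge0.
  (* below the real axis the boundary Re w = 0 is excluded by cd0 *)
  have c0' : 0 < complex.Re w.
    by rewrite lt_neqAle c0 andbT; apply/negP => /eqP /esym /cd0; rewrite leNgt d0.
  by rewrite pmulr_rge0// leNgt d0/= mulrN.
rewrite /clog cE normcX lnXn// -(rmorph_nat (real_complex R) 2).
apply/eqP; rewrite eq_complex/=.
by rewrite !mul0r subr0 addr0 (mulr_natl (ln _)) !eqxx.
Qed.

(** The principal square root lies in the half-plane of [clog_sqr]; on its
    boundary, reached from the negative axis, the imaginary part is positive. *)
Lemma clog_sqrtc z : z != 0 -> 2 * clog (sqrtc z) = clog z.
Proof.
move=> z0; rewrite -[in RHS](sqr_sqrtc z) clog_sqr//.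
- by rewrite sqrtc_eq0.
- by case: z {z0} => a b /=; exact: sqrtr_ge0.
case: z z0 => a b /= _ re0.
have [->|b0] := eqVneq b 0; first by rewrite mul1r sqrtr_ge0.
rewrite mulr_ge0 ?sqrtr_ge0// sgr_ge0 leNgt; apply/negP => _.
have b20 : 0 < b ^+ 2 by rewrite lt_neqAle sqr_ge0 andbT eq_sym sqrf_eq0.
have : `|a| < Num.sqrt (a ^+ 2 + b ^+ 2).
  by rewrite -sqrtr_sqr ltr_sqrt ?ltrDl// ltr_wpDl// sqr_ge0.
move=> ar; have := lerNnormlW (lexx `|a|) => a'.
move/eqP : re0; rewrite sqrtr_eq0 leNgt => /negP; apply.
by rewrite divr_gt0//; lra.
Qed.

Lemma cpow_sqrtc_scale z x a n : z != 0 -> 0 < x ->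
  cpow (sqrtc (z * x%:C)) (2 * n%:R + a%:C) =
  z ^+ n * cpow z (a / 2)%:C * (x `^ (n%:R + a / 2))%:C.
Proof.
move=> z0 x0.
have zx0 : z * x%:C != 0 by rewrite mulf_neq0// (inj_eq (@complexI _) x 0) gt_eqF.
rewrite /cpow sqrtc_eq0 (negPf zx0) (negPf z0).
have -> : (2 * n%:R + a%:C) * clog (sqrtc (z * x%:C)) =
    n%:R * clog z + (a / 2)%:C * clog z + ((n%:R + a / 2) * ln x)%:C.
  have aE : a%:C = (a / 2)%:C * 2 by rewrite -(rmorph_nat (real_complex R)) -rmorphM divfK.
  have -> : ((n%:R + a / 2) * ln x)%:C = (n%:R + (a / 2)%:C) * (ln x)%:C.
    by rewrite -(rmorph_nat (real_complex R)) -rmorphD -rmorphM.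
  rewrite -mulrDl -mulrDr -clog_scale// -(clog_sqrtc zx0) {1}aE.
  by ring.
rewrite !cexpD cexpMn cexp_clog// cexp_real; congr (_ * _).
by rewrite /powR gt_eqF.
Qed.

Lemma cpow_natD z a n : z != 0 -> cpow z (n%:R + a%:C) = z ^+ n * cpow z a%:C.
Proof.
move=> z0; rewrite /cpow (negPf z0) mulrDl cexpD cexpMn cexp_clog//.
Qed.

End complex_powers.

(** * Kummer's transformation *)

Section kummer.
Context {R : realType}.
Implicit Types (z : R[i]) (x a b c y : R).
Local Notation normc := Normc.normc.

(** The terms of the Bessel-Clifford series, that is of 0F1(; y; z) / Gamma(y).
    The reciprocal Gamma values make sense for every real [y]. *)
Definition rgamma_term z y : nat -> R[i] :=
  fun n => z ^+ n * ((Gamma (y + n%:R))^-1 / n`!%:R)%:C.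

(** The weight [g] may grow like a Gamma function: the Gamma function in the
    denominator absorbs this growth and the factorial remains. *)
Lemma cvg_series_rgamma_term z y x (g : nat -> R) :
  0 <= x -> (forall n, 0 <= g n) -> (forall n, g n.+1 <= (x + n%:R) * g n) ->
  cvgn (series (fun n => normc (rgamma_term z y n) * g n)).
Proof.
move=> x0 g0 gS.
have vE n : normc (rgamma_term z y n) * g n =
    normc z ^+ n * `|(Gamma (y + n%:R))^-1| / n`!%:R * g n.
  rewrite /rgamma_term Normc.normcM normcX normc_real normrM.
  rewrite (ger0_norm (x := _ `!%:R^-1)) ?invr_ge0//.
  by rewrite mulrA.
have G n : `|(Gamma (y + n.+1%:R))^-1| * `|y + n%:R| = `|(Gamma (y + n%:R))^-1|.
  by rewrite (GammaV_rec (y + n%:R)) -addrA natr1 normrM mulrC.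
apply: (@cvg_series_hypergeom_ratio _ _ (normc z) x y) => //.
- by move=> n; apply: mulr_ge0 => //; exact: normc_ge0.
- exact: normc_ge0.
move=> n; rewrite !vE -(G n) factS natrM invfM exprS.
set w := normc z ^+ n * `|(Gamma (y + n.+1%:R))^-1| * `|y + n%:R| / n`!%:R.
have w0 : 0 <= w by rewrite !mulr_ge0// ?exprn_ge0 ?normc_ge0// invr_ge0.
have nz : n.+1%:R != 0 :> R by rewrite pnatr_eq0.
apply: (@le_trans _ _ (normc z * w * g n.+1)).
  rewrite le_eqVlt; apply/orP; left; apply/eqP; rewrite /w; field.
  by rewrite nat1r nz pnatr_eq0 -lt0n fact_gt0.
apply: (@le_trans _ _ (normc z * w * ((x + n%:R) * g n))).
  by rewrite ler_wpM2l// mulr_ge0// normc_ge0.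
rewrite le_eqVlt; apply/orP; left; apply/eqP; rewrite /w; ring.
Qed.

(** The terms of M(b, c, z) / Gamma(c), the regularised Kummer function, which is
    entire in [b] and [c]. *)
Definition kummer_term z b c : nat -> R[i] :=
  fun n => (poch b n)%:C * rgamma_term z c n.

Lemma csummable_kummer_term z b c : csummable (kummer_term z b c).
Proof.
rewrite /csummable (_ : (fun n => _) = fun n => normc (rgamma_term z c n) * `|poch b n|).
  apply: (@cvg_series_rgamma_term _ _ `|b|) => // n.
  rewrite pochSr normrM mulrC ler_wpM2r//.
  by rewrite (le_trans (ler_normD _ _))// normr_nat.
by apply/funext => n; rewrite /kummer_term Normc.normcM normc_real mulrC.
Qed.

(** M(b, c, -z) = e^(-z) M(c - b, c, z), regularised.  The coefficient of
    [z^m] in the Cauchy product is a Chu-Vandermonde sum, after all reciprocal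
    Gamma values are reduced to the one at [c + m]. *)
Lemma kummer_transformation z b c :
  csums (kummer_term (- z) b c) (csum (kummer_term z (c - b) c) * cexp (- z)).
Proof.
have := csums_convol (@csummable_kummer_term z (c - b) c) (@csummable_cexp_coeff _ (- z))
  (csummable_csums (@csummable_kummer_term z (c - b) c)) (csums_cexp (- z)).
apply: eq_csums => m.
rewrite /kummer_term /rgamma_term -[in RHS](subKr c b) -poch_vandermonde.
rewrite rmorph_sum mulr_suml; apply: eq_bigr => j _.
have jm : (j <= m)%N by rewrite -ltnS ltn_ord.
rewrite /kummer_term /rgamma_term /cexp_coeff.
rewrite (GammaV_poch (c + j%:R) (m - j)) -addrA -natrD subnKC//.
rewrite -(bin_fact jm) !natrM.
rewrite -[(m - j)`!%:R](rmorph_nat (real_complex R)) -fmorphV.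
have -> : (- z) ^+ m = (-1) ^+ j * z ^+ j * (- z) ^+ (m - j).
  by rewrite -exprNn -exprD subnKC.
rewrite invfM !rmorphM /= !fmorphV !rmorphM !rmorph_nat rmorphXn rmorphN1.
have fE (i : nat) : i`!%:R != 0 :> R[i] by rewrite pnatr_eq0 -lt0n fact_gt0.
have h1 := fE j; have h2 := fE (m - j)%N.
have h3 : 'C(m, j)%:R != 0 :> R[i] by rewrite pnatr_eq0 -lt0n bin_gt0.
(* a reciprocal Gamma value may be zero, so it has to stay atomic *)
set G := (real_complex_def _ (Gamma _))^-1.
have s1 : (-1) ^+ j * (-1) ^+ j = 1 :> R[i] by rewrite -expr2 sqrr_sign.
rewrite -[LHS]mul1r -[X in X * _ = _]s1; field.
by rewrite h1 h2 h3.
Qed.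
End kummer.

(** * Moments of the Laguerre weight *)

Section laguerre.
Context {R : realType}.
Local Notation mu := (@lebesgue_measure R).
Local Notation Rpos := (`]0%R, +oo[%classic : set R).
Implicit Types (z : R[i]) (x a b c y : R).

Lemma poch_oppn (n m : nat) : poch (- n%:R : R) m = (-1) ^+ m * (n ^_ m)%:R.
Proof.
elim: m => [|m IH]; first by rewrite poch0 expr0 ffactn0 mul1r.
rewrite pochSr IH ffactnSr exprS natrM.
have [mn|nm] := leqP m n; first by rewrite natrB//; ring.
by rewrite ffact_small// !mul0r !mulr0 mul0r.
Qed.

Lemma csums_finite (u : nat -> R[i]) N : (forall n, (N <= n)%N -> u n = 0) ->
  csums u (\sum_(i < N) u i).
Proof.
move=> u0.
have E (f : R[i] -> R) : f 0 = 0 ->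
    series (fun n => f (u n)) @ \oo --> \sum_(i < N) f (u i).
  move=> f0; apply: cvg_near_cst; exists N => // n /= Nn.
  rewrite /series/= (@big_cat_nat _ _ _ N)//= big_mkord -[RHS]addr0; congr (_ + _).
  by rewrite big_nat big1// => i /andP[Ni _]; rewrite u0// f0.
by split; rewrite raddf_sum; apply: E.
Qed.

(** The Pochhammer quotient [(b + 1)_k / (b + 1)_j] of the hypergeometric
    definition is written as [(b + 1 + j)_(k - j)], the shape that occurs in
    [poch_vandermonde]. *)
Definition laguerre_coef (k : nat) b (j : nat) : R :=
  'C(k, j)%:R * ((-1) ^+ j * poch (b + 1 + j%:R) (k - j)) / k`!%:R.

Definition laguerre_real k b x : R := \sum_(j < k.+1) laguerre_coef k b j * x ^+ j.

Lemma laguerre_poly_real k b x : -1 < b ->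
  laguerre_poly k b x%:C = (laguerre_real k b x)%:C.
Proof.
move=> b1.
have D : b%:C + 1 = (b + 1)%:C by rewrite rmorphD.
have N : - k%:R = (- k%:R)%:C :> R[i] by rewrite rmorphN rmorph_nat.
rewrite /laguerre_poly /kummerM D N.
have := @csums_finite (fun n =>
  cpoch (- k%:R)%:C n / cpoch (b + 1)%:C n * (x%:C ^+ n / n`!%:R)) k.+1.
move=> /(_ _)/csumE ->; last first.
  by move=> n kn; rewrite !cpoch_real poch_oppn ffact_small// mulr0 !mul0r.
rewrite mulr_sumr /laguerre_real rmorph_sum; apply: eq_bigr => j _.
have jk : (j <= k)%N by rewrite -ltnS ltn_ord.
rewrite !cpoch_real.
transitivity ((poch (b + 1) k / k`!%:R *
    (poch (- k%:R) j / poch (b + 1) j * (x ^+ j / j`!%:R)))%:C).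
  by rewrite !rmorphM /= !fmorphV rmorphXn !rmorph_nat.
congr (_%:C).
have -> : poch (b + 1) k = poch (b + 1) j * poch (b + 1 + j%:R) (k - j).
  by rewrite -pochD subnKC.
rewrite /laguerre_coef poch_oppn -bin_ffact natrM.
have h1 : poch (b + 1) j != 0 by rewrite gt_eqF// poch_gt0//; lra.
have fE (i : nat) : i`!%:R != 0 :> R by rewrite pnatr_eq0 -lt0n fact_gt0.
have h2 := fE j; have h3 := fE k.
by field; rewrite h1 h2 h3.
Qed.

(** Written as a combination of Euler integrands rather than as a product, so that
    its integral is a sum of values of Gamma. *)
Definition laguerre_density k b n x : R :=
  \sum_(j < k.+1) laguerre_coef k b j * gamma_density (b + 1 + n%:R + j%:R) x.

Lemma gamma_densityXn a x n : 0 < x ->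
  gamma_density (a + n%:R) x = x ^+ n * gamma_density a x.
Proof.
move=> x0; rewrite /gamma_density.
have -> : x `^ (a + n%:R - 1) = x ^+ n * x `^ (a - 1).
  rewrite -powR_mulrn ?ltW// -powRD ?(gt_eqF x0) ?implybT//.
  by congr (_ `^ _); ring.
by rewrite mulrA.
Qed.

Lemma laguerre_densityE k b n x : 0 < x ->
  laguerre_density k b n x = gamma_density (b + 1 + n%:R) x * laguerre_real k b x.
Proof.
move=> x0; rewrite mulr_sumr; apply: eq_bigr => j _.
by rewrite gamma_densityXn//; ring.
Qed.

Lemma integrable_sum_gamma_density (m : nat) (c : nat -> R) a : 0 < a ->
  mu.-integrable Rpos
    (EFin \o (fun x => \sum_(j < m) c j * gamma_density (a + j%:R) x)).
Proof.
move=> a0; rewrite (_ : EFin \o _ = (fun x =>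
    \sum_(j < m) (c j)%:E * (gamma_density (a + j%:R) x)%:E)%E).
  apply: integrable_sum => // j _; apply: integrableZl => //.
  by apply: integrable_gamma_density; rewrite ltr_wpDr.
by apply/funext => x /=; rewrite -sumEFin.
Qed.

Lemma Rintegral_sum_gamma_density (m : nat) (c : nat -> R) a : 0 < a ->
  \int[mu]_(x in Rpos) (\sum_(j < m) c j * gamma_density (a + j%:R) x) =
  \sum_(j < m) c j * euler_gamma (a + j%:R).
Proof.
move=> a0.
have I j : mu.-integrable Rpos (EFin \o gamma_density (a + j%:R)).
  by apply: integrable_gamma_density; rewrite ltr_wpDr.
elim: m => [|m IH].
  rewrite big_ord0; under eq_Rintegral do rewrite big_ord0.
  by rewrite Rintegral_cst// mul0r.
under eq_Rintegral do rewrite big_ord_recr/=.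
rewrite big_ord_recr/= RintegralD//=.
- by rewrite IH RintegralZl.
- exact: integrable_sum_gamma_density.
- rewrite (_ : EFin \o _ =
    (fun x => (c m)%:E * (gamma_density (a + m%:R) x)%:E)%E)//.
  by apply: integrableZl => //; exact: I.
Qed.

Lemma integrable_laguerre_density k b n : -1 < b ->
  mu.-integrable Rpos (EFin \o laguerre_density k b n).
Proof.
move=> b1; apply: integrable_sum_gamma_density.
by rewrite ltr_wpDr//; lra.
Qed.

(** [poch_vandermonde] with parameters [b + 1 + n] and [b + 1], whose difference
    is [- n].  For [n < k] the result is 0, which is the orthogonality of the
    Laguerre polynomial to lower powers. *)
Lemma Rintegral_laguerre_density k b n : -1 < b ->
  \int[mu]_(x in Rpos) laguerre_density k b n x =
  Gamma (b + 1 + n%:R) * poch (- n%:R) k / k`!%:R.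
Proof.
move=> b1.
have a0 : 0 < b + 1 + n%:R by rewrite ltr_wpDr//; lra.
rewrite (Rintegral_sum_gamma_density k.+1 (laguerre_coef k b) a0).
have -> : - n%:R = (b + 1) - (b + 1 + n%:R) :> R by ring.
rewrite -poch_vandermonde mulr_sumr mulr_suml; apply: eq_bigr => j _.
by rewrite /laguerre_coef euler_gammaD// Gamma_posE//; ring.
Qed.

Lemma Rintegral_norm_laguerre_density k b n : -1 < b ->
  \int[mu]_(x in Rpos) `|laguerre_density k b n x| <=
  \sum_(j < k.+1) `|laguerre_coef k b j| * Gamma (b + 1 + n%:R + j%:R).
Proof.
move=> b1.
have a0 : 0 < b + 1 + n%:R by rewrite ltr_wpDr//; lra.
have -> : \sum_(j < k.+1) `|laguerre_coef k b j| * Gamma (b + 1 + n%:R + j%:R) =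
    \sum_(j < k.+1) `|laguerre_coef k b j| * euler_gamma (b + 1 + n%:R + j%:R).
  by apply: eq_bigr => j _; rewrite Gamma_posE// ltr_wpDr.
rewrite -(Rintegral_sum_gamma_density k.+1 (fun j => `|laguerre_coef k b j|) a0).
apply: le_Rintegral => //.
- by apply: integrable_norm; exact: integrable_laguerre_density.
- exact: (integrable_sum_gamma_density k.+1 (fun j => `|laguerre_coef k b j|) a0).
- move=> x _; rewrite (le_trans (ler_norm_sum _ _ _))// ler_sum// => j _.
  by rewrite normrM (ger0_norm (gamma_density_ge0 _ _)).
Qed.

End laguerre.

(** * The integral of the Bessel function *)

Section assembly.
Context {R : realType}.
Local Notation mu := (@lebesgue_measure R).
Local Notation Rpos := (`]0%R, +oo[%classic : set R).
Implicit Types (z rho : R[i]) (x a b c y : R).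
Local Notation normc := Normc.normc.

Lemma real_complex_neq0 x : x != 0 -> x%:C != 0 :> R[i].
Proof. by move=> x0; rewrite (inj_eq (@complexI _) x 0). Qed.

(** The factor [x^(a/2)] is kept inside the real power, so that it later cancels
    against the weight [x^(b - a/2)]. *)
Lemma csums_besselJ a rho x : rho != 0 -> 0 < x ->
  csums (fun n => cpow rho (a / 2)%:C * rgamma_term (- rho) (a + 1) n
                  * (x `^ (n%:R + a / 2))%:C)
        (besselJ a%:C (2 * sqrtc (rho * x%:C))).
Proof.
move=> rho0 x0; set u := fun n => _ * _ * _.
have us : csummable u.
  rewrite /csummable (_ : (fun n => _) =
    fun n => (normc (cpow rho (a / 2)%:C) * x `^ (a / 2)) *
             (normc (rgamma_term (- rho) (a + 1) n) * x ^+ n)).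
    apply: is_cvg_seriesZ; apply: (@cvg_series_rgamma_term _ _ _ x) => [|n|n].
    - exact: ltW.
    - by rewrite exprn_ge0// ltW.
    - by rewrite exprS ler_wpM2r ?lerDl// exprn_ge0// ltW.
  apply/funext => n; rewrite /u !Normc.normcM normc_real ger0_norm ?powR_ge0//.
  rewrite powRD ?(gt_eqF x0) ?implybT// powR_mulrn ?ltW//.
  by ring.
suff -> : besselJ a%:C (2 * sqrtc (rho * x%:C)) = csum u by exact: csummable_csums.
congr csum; apply/funext => n.
rewrite [2 * sqrtc _]mulrC mulfK ?pnatr_eq0// cpow_sqrtc_scale//.
have -> : a%:C + n%:R + 1 = (a + 1 + n%:R)%:C by rewrite !rmorphD rmorph_nat addrAC.
rewrite cGamma_real /u /rgamma_term (exprNn rho) !rmorphM !fmorphV !rmorph_nat invfM.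
by ring.
Qed.

(** Termwise integration.  The L1 norms of the terms grow at most by the factor
    [b + 1 + k + n] from [n] to [n + 1], because each Gamma value in the bound
    does. *)
Lemma integral_laguerre_bessel k a b rho : -1 < b -> rho != 0 ->
  let f := fun x : R => (x `^ (b - a / 2) * expR (- x))%:C
    * besselJ a%:C (2 * sqrtc (rho * x%:C)) * laguerre_poly k b x%:C in
  cintegrable Rpos f /\
  csums (fun n => cpow rho (a / 2)%:C * rgamma_term (- rho) (a + 1) n
     * (Gamma (b + 1 + n%:R) * poch (- n%:R) k / k`!%:R)%:C) (cintegral Rpos f).
Proof.
move=> b1 rho0 f.
have [|||||fi fs] := @cintegral_series R Rpos _
  (fun n => cpow rho (a / 2)%:C * rgamma_term (- rho) (a + 1) n)
  (fun n => laguerre_density k b n)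
  (fun n => \sum_(j < k.+1) `|laguerre_coef k b j| * Gamma (b + 1 + n%:R + j%:R)) f.
- exact: measurable_itv.
- by move=> n; exact: integrable_laguerre_density.
- by move=> n; exact: Rintegral_norm_laguerre_density.
- rewrite (_ : (fun n => _) = fun n => normc (cpow rho (a / 2)%:C) *
    (normc (rgamma_term (- rho) (a + 1) n) *
     \sum_(j < k.+1) `|laguerre_coef k b j| * Gamma (b + 1 + n%:R + j%:R)));
    last first.
    by apply/funext => n; rewrite Normc.normcM mulrA.
  apply: is_cvg_seriesZ.
  (* the largest argument b + 1 + j of the Gamma values that occur for n = 0 *)
  pose x := b + 1 + k%:R.
  apply: (@cvg_series_rgamma_term _ _ _ x) => [|n|n].
  - by rewrite /x addr_ge0//; lra.
  - apply: sumr_ge0 => j _; rewrite mulr_ge0// ltW// Gamma_gt0//.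
    by rewrite ltr_wpDr// ltr_wpDr//; lra.
  rewrite mulr_sumr; apply: ler_sum => j _; rewrite mulrCA ler_wpM2l//.
  have p0 : 0 < b + 1 + n%:R + j%:R by rewrite ltr_wpDr// ltr_wpDr//; lra.
  have -> : b + 1 + n.+1%:R + j%:R = b + 1 + n%:R + j%:R + 1%:R by rewrite -natr1; ring.
  rewrite Gamma_poch// pochSr poch0 mul1r addr0 ler_wpM2r//; first exact/ltW/Gamma_gt0.
  have : j%:R <= k%:R :> R by rewrite ler_nat -ltnS ltn_ord.
  by rewrite /x; lra.
- move=> x; rewrite /= in_itv/= andbT => x0.
  pose w := x `^ (b - a / 2) * expR (- x) * laguerre_real k b x.
  have := csumsZ w%:C (csums_besselJ a rho0 x0).
  have -> : w%:C * besselJ a%:C (2 * sqrtc (rho * x%:C)) = f x.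
    by rewrite /w /f laguerre_poly_real// !rmorphM/=; ring.
  apply: eq_csums => n.
  have -> : laguerre_density k b n x = x `^ (n%:R + a / 2) * w.
    rewrite laguerre_densityE// /gamma_density /w.
    have -> : b + 1 + n%:R - 1 = (n%:R + a / 2) + (b - a / 2) by ring.
    rewrite (@powRD _ x (n%:R + a / 2)) ?(gt_eqF x0) ?implybT//.
    by ring.
  by rewrite (rmorphM (real_complex R) (x `^ (n%:R + a / 2))); ring.
split=> //.
by apply: eq_csums fs => n; rewrite Rintegral_laguerre_density.
Qed.

(** In the singular branch this is the definition.  In the other branch neither
    [Gamma(b - a + 1)] nor [Gamma(a + k + 1)] is 0, so that they cancel. *)
Lemma gamma_laguerreE k a b z : -1 < b ->
  gamma_laguerre k a b z =
  (Gamma (b + 1 + k%:R))%:C * csum (kummer_term z (a - b) (a + k%:R + 1)).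
Proof.
move=> b1; rewrite /gamma_laguerre.
have bk : (b + k%:R + 1) = b + 1 + k%:R by rewrite addrAC.
case: ifPn => [_|/asboolPn/not_orP[np1 np2]].
  rewrite cGamma_real bk; congr (_ * csum _); apply/funext => n.
  rewrite cpoch_real cGamma_real /kummer_term /rgamma_term [a + k%:R + n%:R + 1]addrAC.
  by rewrite rmorphM !fmorphV rmorph_nat invfM mulrA.
have c0 := Gamma_neq0 np2; have d0 := Gamma_neq0 np1.
rewrite /laguerre_fun.
have -> : 1 + (b - a)%:C + (a + k%:R)%:C = (b + 1 + k%:R)%:C.
  by rewrite -[1]/(1%:C) -!rmorphD; congr (_%:C); ring.
have -> : (b - a)%:C + 1 = (b - a + 1)%:C by rewrite (rmorphD _ (b - a) 1).
have cE : (a + k%:R)%:C + 1 = (a + k%:R + 1)%:C by rewrite (rmorphD _ (a + k%:R) 1).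
rewrite cE !cGamma_real.
set c := a + k%:R + 1 in np2 c0 cE *.
have -> : kummerM (- (b - a)%:C) c%:C z = (Gamma c)%:C * csum (kummer_term z (a - b) c).
  rewrite /kummerM; apply: csumE.
  have := csumsZ (Gamma c)%:C (csummable_csums (@csummable_kummer_term _ z (a - b) c)).
  apply: eq_csums => n.
  have -> : - (b - a)%:C = (a - b)%:C by rewrite -rmorphN opprB.
  rewrite !cpoch_real /kummer_term /rgamma_term.
  have E := GammaV_poch c n.
  have pn0 : poch c n != 0.
    by apply: contraNneq c0 => p0; rewrite -invr_eq0 E p0 mul0r.
  have -> : (Gamma (c + n%:R))^-1 = (Gamma c)^-1 / poch c n by rewrite E mulrC mulKf.
  rewrite !rmorphM !fmorphV rmorph_nat.
  have h1 := real_complex_neq0 c0; have h2 := real_complex_neq0 pn0.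
  have h3 : n`!%:R != 0 :> R[i] by rewrite pnatr_eq0 -lt0n fact_gt0.
  by field; rewrite h1 h2 h3.
have h1 := real_complex_neq0 c0; have h2 := real_complex_neq0 d0.
by field; rewrite h1 h2.
Qed.

(** [(- (k + n))_k = (-1)^k (k + n)! / n!], and [Gamma(b + 1 + k + n)] differs from
    [Gamma(b + 1 + k)] by a Pochhammer symbol. *)
Lemma shifted_moment_term k a b rho n : -1 < b ->
  rgamma_term (- rho) (a + 1) (k + n)
    * (Gamma (b + 1 + (k + n)%:R) * poch (- (k + n)%:R) k / k`!%:R)%:C =
  rho ^+ k / k`!%:R * (Gamma (b + 1 + k%:R))%:C
    * kummer_term (- rho) (b + 1 + k%:R) (a + k%:R + 1) n.
Proof.
move=> b1; rewrite /kummer_term /rgamma_term poch_oppn.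
have -> : b + 1 + (k + n)%:R = b + 1 + k%:R + n%:R by rewrite natrD addrA.
have -> : a + 1 + (k + n)%:R = a + k%:R + 1 + n%:R by rewrite natrD; ring.
have F : ((k + n) ^_ k * n`! = (k + n)`!)%N.
  by rewrite -[RHS](@ffact_fact (k + n) k) ?leq_addr// addKn.
have b0 : 0 < b + 1 + k%:R by rewrite ltr_wpDr//; lra.
rewrite (Gamma_poch n b0) -F natrM exprD [(- rho) ^+ k]exprNn.
have h0 : (k + n) ^_ k != 0 :> nat by rewrite -lt0n ffact_gt0 leq_addr.
rewrite invfM !rmorphM /= !fmorphV !rmorph_nat rmorphXn rmorphN1.
(* the reciprocal Gamma value may be zero, so it has to stay atomic *)
set G := (real_complex_def _ (Gamma (a + k%:R + 1 + _)))^-1.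
(* one sign comes from the moment, the other one from (- rho) ^+ k *)
have s1 : (-1) ^+ k * (-1) ^+ k = 1 :> R[i] by rewrite -expr2 sqrr_sign.
have h1 (m : nat) : m`!%:R != 0 :> R[i] by rewrite pnatr_eq0 -lt0n fact_gt0.
have h2 : ((k + n) ^_ k)%:R != 0 :> R[i] by rewrite pnatr_eq0.
rewrite -[RHS]mul1r -[X in _ = X * _]s1; field.
by rewrite !h1 h2.
Qed.

End assembly.

Theorem corollary20 (R : realType) (k : nat) (alpha beta : R) (rho : R[i])
  (hbeta : -1 < beta) (hrho : rho != 0) :
  let f := fun x : R =>
    (x `^ (beta - alpha / 2) * expR (- x))%:C
    * besselJ alpha%:C (2 * sqrtc (rho * x%:C))
    * laguerre_poly k beta x%:C in
  cintegrable `]0, +oo[ f /\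
  cintegral `]0, +oo[ f =
    cexp (- rho) * cpow rho (k%:R + alpha / 2)%:C / k`!%:R
    * gamma_laguerre k alpha beta rho.
Proof.
move=> f.
have [fi fs] := integral_laguerre_bessel k alpha hbeta hrho.
split; first exact: fi.
move: fs; rewrite (csums_shift (k := k)); last first.
  by move=> n nk; rewrite poch_oppn ffact_small// mulr0 mulr0 mul0r mulr0.
move=> fs.
pose b := beta + 1 + k%:R; pose c := alpha + k%:R + 1.
have := kummer_transformation rho b c.
have -> : c - b = alpha - beta by rewrite /c /b; ring.
move=> /(csumsZ (cpow rho (alpha / 2)%:C * (rho ^+ k / k`!%:R * (Gamma b)%:C))) K.
rewrite (csums_unique fs (eq_csums _ K)); last first.
  by move=> n; rewrite -mulrA -shifted_moment_term// mulrA.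
rewrite gamma_laguerreE//.
have -> : (k%:R + alpha / 2)%:C = k%:R + (alpha / 2)%:C :> R[i].
  by rewrite rmorphD rmorph_nat.
by rewrite cpow_natD//; rewrite /b /c; ring.
Qed.
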